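(* Let $\mathcal{D}$ be a non-empty set. Then $(\mathcal{B}r(\mathcal{D}),\star)$ is a non-associative permutative algebra, i.e. $x\star(y\star z)=y\star(x\star z)$ for all $x,y,z\in\mathcal{B}r(\mathcal{D})$.
   Context: $K$ is a field of characteristic zero; all vector spaces and algebras are over $K$. A (left) non-associative permutative algebra is a vector space $A$ with a bilinear product $\star:A\otimes A\to A$ such that $x\star(y\star z)=y\star(x\star z)$ for all $x,y,z\in A$. $\mathcal{T}_P^{\mathcal{D}}$ is the set of planar rooted trees (finite, nonempty) whose vertices are decorated by elements of $\mathcal{D}$. For $d\in\mathcal{D}$ and $t_1,\ldots,t_n\in\mathcal{T}_P^{\mathcal{D}}$ ($n\ge 0$), $B_d(t_1\ldots t_n)$ is the planar rooted tree obtained by grafting $t_1,\ldots,t_n$, in this order from left to right, on a common root decorated by $d$. $\mathcal{B}r(\mathcal{D})=K\mathcal{T}_P^{\mathcal{D}}$ is the vector space with basis $\mathcal{T}_P^{\mathcal{D}}$ (the underlying space of the free brace algebra generated by $\mathcal{D}$). The bilinear product $\star$ on $\mathcal{B}r(\mathcal{D})$ is defined, for $t\in\mathcal{T}_P^{\mathcal{D}}$ and $t'=B_d(t_1\ldots t_n)\in\mathcal{T}_P^{\mathcal{D}}$, by $$t\star t'=\sum_{i=0}^n B_d(t_1\ldots t_i\,t\,t_{i+1}\ldots t_n).$$ *)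

(* Defs.v *)
From HB Require Import structures.
From mathcomp Require Import all_boot all_order all_algebra.
From mathcomp Require Import finmap.
From mathcomp Require Import monalg.

Set Implicit Arguments.
Unset Strict Implicit.
Unset Printing Implicit Defensive.

Import GRing.Theory.

Local Open Scope ring_scope.

(* A planar rooted tree is a decorated root together with the finite sequence,
   from left to right, of the subtrees grafted on it: [B d [:: t1; ..; tn]] is
   B_d(t1 ... tn).  In particular trees are nonempty, and the one-vertex tree
   decorated by d is [B d [::]]. *)
Inductive ptree (D : Type) : Type := B of D & seq (ptree D).

(* Encoding of trees into [GenTree.tree], only used to equip [ptree D] with its
   choiceType structure. *)
Section PtreeChoice.
Variable D : choiceType.

Fixpoint ptree_encode (t : ptree D) : GenTree.tree D :=
  let: B d s := t in
  GenTree.Node 0 (GenTree.Leaf d :: map ptree_encode s).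

Fixpoint ptree_decode (u : GenTree.tree D) : option (ptree D) :=
  if u is GenTree.Node _ (GenTree.Leaf d :: us)
  then Some (B d (pmap ptree_decode us)) else None.

Lemma ptree_encodeK : pcancel ptree_encode ptree_decode.
Proof.
rewrite /pcancel; fix IH 1 => -[d s] /=; congr (Some (B d _)).
by elim: s => //= t s ->; rewrite IH.
Qed.

HB.instance Definition _ := Choice.copy (ptree D) (pcan_type ptree_encodeK).

End PtreeChoice.

(* The K-vector space with basis the trees: finitely supported functions from
   [ptree D] to K. The basis vector of the tree t is [<< t >>] and the
   coefficient of t in x is [x@_t]. *)
Notation Br K D := {malg K[ptree D]}.

Section Star.
Variables (K : fieldType) (D : choiceType).

(* t grafted on the root of t', in each of the n + 1 possible positions. *)
Definition star_tree (t t' : ptree D) : Br K D :=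
  let: B d s := t' in
  \sum_(i < (size s).+1) << B d (take i s ++ t :: drop i s) >>.

(* Bilinear extension of [star_tree]. *)
Definition star (x y : Br K D) : Br K D :=
  \sum_(t <- msupp x) \sum_(t' <- msupp y) (x@_t * y@_t') *: star_tree t t'.

End Star.

Definition nap_algebra (K : fieldType) (A : lmodType K) (mul : A -> A -> A)
    : Prop :=
  bilinear_for *:%R *:%R mul /\
  forall x y z : A, mul x (mul y z) = mul y (mul x z).

(* Main.v *)
Require Import Defs.
From HB Require Import structures.
From mathcomp Require Import all_boot all_order all_algebra.
From mathcomp Require Import finmap.
From mathcomp Require Import monalg.

(** Write L_t for the linear endomorphism z |-> t * z of Br(D), for a tree t.
    By bilinearity the permutative identity says exactly that the L_t commute
    with each other, and this can be tested on trees B_d(s). On such a tree,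
    L_a after L_b inserts b into the word s in every possible way and then a
    into the resulting word in every possible way. As a and b only ever become
    siblings, the final words are the shuffles of s with the letters a and b in
    either relative order, each obtained once, and this description is
    symmetric in a and b ([sum_insertC]). *)

Set Implicit Arguments.
Unset Strict Implicit.
Unset Printing Implicit Defensive.

Import GRing.Theory.
Local Open Scope ring_scope.

Section SumInsert.
Variables (T : Type) (V : nmodType).

Definition sum_insert (F : seq T -> V) (t : T) (s : seq T) : V :=
  \sum_(i < (size s).+1) F (take i s ++ t :: drop i s).

Lemma sum_insert_nil F t : sum_insert F t [::] = F [:: t].
Proof. by rewrite /sum_insert big_ord1. Qed.

Lemma sum_insert_cons F t u s :
  sum_insert F t (u :: s) =
    F (t :: u :: s) + sum_insert (fun r => F (u :: r)) t s.
Proof. by rewrite /sum_insert big_ord_recl. Qed.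

Lemma eq_sum_insert F G t s : F =1 G -> sum_insert F t s = sum_insert G t s.
Proof. by move=> FG; apply: eq_bigr => i _; rewrite FG. Qed.

Lemma sum_insertD F G t s :
  sum_insert (fun r => F r + G r) t s = sum_insert F t s + sum_insert G t s.
Proof. exact: big_split. Qed.

(** Double insertions into u :: s either put one of the letters first and the
    other anywhere after it, or keep u first. The former contribute an
    expression symmetric in a and b, the latter are double insertions into s,
    for the function F (u :: _); hence the induction on s for all F. *)
Lemma sum_insertC F a b s :
  sum_insert (sum_insert F a) b s = sum_insert (sum_insert F b) a s.
Proof.
elim: s F => [|u s IHs] F.
  by rewrite !(sum_insert_nil, sum_insert_cons) addrC.
have expand x y : sum_insert (sum_insert F x) y (u :: s) =
    F (x :: y :: u :: s) + F (y :: x :: u :: s)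
    + (sum_insert (fun r => F (y :: u :: r)) x s
       + sum_insert (fun r => F (x :: u :: r)) y s)
    + sum_insert (sum_insert (fun r => F (u :: r)) x) y s.
  rewrite !sum_insert_cons.
  under [X in _ + X]eq_sum_insert => r do rewrite sum_insert_cons.
  by rewrite sum_insertD !addrA.
rewrite !expand IHs; congr (_ + _ + _); exact: addrC.
Qed.

End SumInsert.

Section LinearExtension.
Variables (K : fieldType) (T : choiceType) (V : lmodType K).
Implicit Types (f : T -> V) (x : {malg K[T]}).

Definition linext f x : V := \sum_(t <- msupp x) x@_t *: f t.

(** The support of a linear combination is not determined by the supports of
    its terms; a common superset E lets all the sums share one index set. *)
Lemma linextEw (E : {fset T}) f x : (msupp x `<=` E)%fset ->
  linext f x = \sum_(t <- E) x@_t *: f t.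
Proof.
move=> sub_xE; rewrite /linext (big_fset_incl _ sub_xE) // => t _ /mcoeff_outdom->.
by rewrite scale0r.
Qed.

Lemma linext_linear f : linear (linext f).
Proof.
move=> c x y; pose E := (msupp x `|` msupp y)%fset.
have subxE : (msupp x `<=` E)%fset by exact: fsubsetUl.
have subyE : (msupp y `<=` E)%fset by exact: fsubsetUr.
have subE : (msupp (c *: x + y) `<=` E)%fset.
  exact: fsubset_trans (msuppD_le _ _) (fsetSU _ (msuppZ_le _ _)).
rewrite (linextEw _ subxE) (linextEw _ subyE) (linextEw _ subE).
rewrite scaler_sumr -big_split; apply: eq_bigr => t _ /=.
by rewrite mcoeffD mcoeffZ scalerDl scalerA.
Qed.

HB.instance Definition _ f :=
  GRing.isLinear.Build K {malg K[T]} V *:%R (linext f) (linext_linear f).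

Lemma linextU f t : linext f << t >> = f t.
Proof. by rewrite /linext msuppU oner_eq0 big_seq_fset1 mcoeffUU scale1r. Qed.

End LinearExtension.

Section Permutativity.
Variables (K : fieldType) (D : choiceType).
Implicit Types (a b t : ptree D) (x y z : Br K D).

Local Notation L t := (linext (@star_tree K D t)).

(** Shows [star] as x-linear through [linext] and reduces its y-dependence to
    the endomorphisms L_t. *)
Lemma star_linext x y : star x y = linext (fun t => L t y) x.
Proof.
rewrite /star /linext; apply: eq_bigr => t _; rewrite scaler_sumr.
by apply: eq_bigr => t' _; rewrite scalerA.
Qed.

Lemma star_bilinear : bilinear_for *:%R *:%R (@star K D).
Proof.
split=> [y|x] c u v; rewrite /= !star_linext; first exact: linearP.
rewrite /linext scaler_sumr -big_split; apply: eq_bigr => t _ /=.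
by rewrite -!/(linext _ _) linearP scalerDr !scalerA mulrC.
Qed.

Lemma star_treeC a b t : L a (star_tree K b t) = L b (star_tree K a t).
Proof.
case: t => d s.
have insert2 u v : L u (star_tree K v (B d s)) =
    sum_insert (sum_insert (fun r => << B d r >>) u) v s.
  by rewrite linear_sum; apply: eq_bigr => i _ /=; rewrite linextU.
by rewrite !insert2 sum_insertC.
Qed.

Lemma left_star_tree_commute a b z : L a (L b z) = L b (L a z).
Proof.
rewrite [L b z]/linext [L a z]/linext !linear_sum; apply: eq_bigr => t _.
by rewrite !linearZ /= star_treeC.
Qed.

Lemma star_permutative x y z : star x (star y z) = star y (star x z).
Proof.
have expand u v : star u (star v z) =
    \sum_(a <- msupp u) \sum_(b <- msupp v) (u@_a * v@_b) *: L a (L b z).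
  rewrite star_linext; apply: eq_bigr => a _.
  rewrite star_linext [X in L a X]/linext (linear_sum (L a)) scaler_sumr.
  by apply: eq_bigr => b _; rewrite linearZ scalerA.
rewrite !expand exchange_big; apply: eq_bigr => b _; apply: eq_bigr => a _.
by rewrite mulrC left_star_tree_commute.
Qed.

End Permutativity.

Theorem proposition8 (K : fieldType) (charK0 : [pchar K]%R =i pred0)
    (D : choiceType) (D_nonempty : inhabited D) :
  @nap_algebra K (Br K D) (@star K D).
Proof. by split; [exact: star_bilinear | exact: star_permutative]. Qed.
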